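(* Let $X$ be a locally compact Hausdorff space with a countable base. Consider a strictly positive function $f_0\in C_0(X)$ and a subset $M$ of $C_0(X)$ that separates the points of $X$. Then $\{f_0\}\cup f_0M\cup f_0M^2$ is a Korovkin subset of $C_0(X)$. Moreover, if $M$ is finite, say $M=\{f_1,\dots,f_n\}$, $n\geq 1$, then $\{f_0,f_0f_1,\dots,f_0f_n,f_0\sum_{i=1}^n f_i^2\}$ is a Korovkin subset of $C_0(X)$. Finally, if $f_0$ is also injective, then $\{f_0,f_0^2,f_0^3\}$ is a Korovkin subset of $C_0(X)$.
   Context: $C_0(X)$ is the Banach lattice of real-valued continuous functions on $X$ vanishing at infinity (equal to $C(X)$, all continuous functions, if $X$ is compact), with the sup-norm and pointwise order. $f_0M:=\{f_0 f: f\in M\}$ and $f_0M^2:=\{f_0f^2: f\in M\}$. Strictly positive means $f_0(x)>0$ for all $x\in X$. A subset $S$ of a Banach lattice $E$ is a Korovkin subset of $E$ if for every sequence $(L_n)_{n\geq1}$ of positive linear operators from $E$ into $E$ satisfying $\sup_{n\ge1}\|L_n\|<+\infty$ and $\lim_{n\to\infty}L_n(g)=g$ (in norm) for every $g\in S$, one has $\lim_{n\to\infty}L_n(f)=f$ (in norm) for every $f\in E$. *)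

(* Defs.v *)
From HB Require Import structures.
From mathcomp Require Import all_boot all_order all_algebra.
From mathcomp Require Import all_classical all_reals all_analysis.
From mathcomp Require Import ring lra.

Set Implicit Arguments.
Unset Strict Implicit.
Unset Printing Implicit Defensive.

Import Order.TTheory GRing.Theory Num.Theory.
Import numFieldNormedType.Exports.

Local Open Scope classical_set_scope.
Local Open Scope ring_scope.

(* Real Banach lattices: a complete norm, a vector-space order with finite
   infima and suprema, and a norm monotone in the modulus |x| = x \/ (- x). The
   order is a field, not the one of Order.POrder, because Hierarchy Builder
   refuses a new join of ordered types with normed modules: Num.NumDomain would
   have to inherit from it. *)
HB.mixin Record isBanachLattice (R : realType) E
    of CompleteNormedModule R E := {
  bl_le : E -> E -> Prop ;
  bl_meet : E -> E -> E ;
  bl_join : E -> E -> E ;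
  bl_le_refl : forall x, bl_le x x ;
  bl_le_anti : forall x y, bl_le x y -> bl_le y x -> x = y ;
  bl_le_trans : forall y x z, bl_le x y -> bl_le y z -> bl_le x z ;
  bl_le_meet : forall z x y, bl_le z (bl_meet x y) <-> bl_le z x /\ bl_le z y ;
  bl_join_le : forall x y z, bl_le (bl_join x y) z <-> bl_le x z /\ bl_le y z ;
  bl_leD2r : forall z x y : E, bl_le x y -> bl_le (x + z) (y + z) ;
  bl_scale_ge0 : forall (a : R) (x : E),
    0 <= a -> bl_le 0 x -> bl_le 0 (a *: x) ;
  bl_le_norm : forall x y : E,
    bl_le (bl_join x (- x)) (bl_join y (- y)) -> `|x| <= `|y|
}.

#[short(type="banachLatticeType")]
HB.structure Definition BanachLattice (R : realType) :=
  {E of CompleteNormedModule R E & isBanachLattice R E}.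

Section korovkin.
Context {R : realType} {E : banachLatticeType R}.

Definition positive_operator (L : E -> E) :=
  forall f : E, bl_le 0 f -> bl_le 0 (L f).

(* Valued in the extended reals: it is +oo when L is unbounded. *)
Definition operator_norm (L : E -> E) : \bar R :=
  ereal_sup [set `|L f|%:E | f in [set f : E | `|f| <= 1]].

Definition korovkin_subset (S : set E) :=
  forall L : nat -> {linear E -> E},
    (forall n, positive_operator (L n)) ->
    (ereal_sup (range (fun n => operator_norm (L n))) < +oo)%E ->
    (forall g, S g -> L n g @[n --> \oo] --> g) ->
    forall f, L n f @[n --> \oo] --> f.

End korovkin.

Definition vanishes_at_infinity (R : realType) (X : topologicalType)
    (f : X -> R) :=
  forall e, 0 < e -> compact [set x | e <= `|f x|].

Definition C0_fun (R : realType) (X : topologicalType) : {pred X -> R} :=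
  mem [set f : X -> R | continuous f /\ vanishes_at_infinity f].
Arguments C0_fun : clear implicits.

Record C0 (R : realType) (X : topologicalType) :=
  MkC0 { C0_val :> X -> R ; _ : C0_val \in C0_fun R X }.

HB.instance Definition _ (R : realType) (X : topologicalType) :=
  [isSub for @C0_val R X].
HB.instance Definition _ (R : realType) (X : topologicalType) :=
  [Choice of C0 R X by <:].

Section C0_closure.
Context {R : realType} {X : topologicalType}.
Implicit Types f g h : X -> R.

Lemma C0_funP f :
  reflect (continuous f /\ vanishes_at_infinity f) (f \in C0_fun R X).
Proof. by apply: (iffP idP); rewrite inE. Qed.

Lemma closed_level_set (e : R) h :
  continuous h -> closed [set x | e <= `|h x|].
Proof.
move=> ch; apply: (@preimage_closed _ _ (fun x => `|h x|) [set y | e <= y]).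
  by move=> x _; apply: cvg_norm; exact: ch.
exact: closed_ge.
Qed.

Lemma vanishes_dominated (c : R) f g h : continuous h ->
  vanishes_at_infinity f -> vanishes_at_infinity g ->
  (forall x, `|h x| <= c * (`|f x| + `|g x|)) -> vanishes_at_infinity h.
Proof.
move=> ch vf vg hfg e e0.
pose c' : R := `|c| + 1.
have c'0 : 0 < c' by rewrite /c'; have := normr_ge0 c; lra.
have d0 : 0 < e / (c' *+ 2) by rewrite divr_gt0// pmulrn_lgt0.
apply: (subclosed_compact _ (compactU (vf _ d0) (vg _ d0))).
  exact: closed_level_set.
move=> x /= ehx; apply/orP; rewrite -[_ || _]negbK negb_or -!ltNge.
apply/negP => /andP[fx gx].
have : `|h x| <= c' * (`|f x| + `|g x|).
  apply: (le_trans (hfg x)); apply: ler_wpM2r.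
    by rewrite addr_ge0.
  by rewrite /c'; have := ler_norm c; lra.
apply/negP; rewrite -ltNge (lt_le_trans _ ehx)//.
have -> : e = c' * (e / (c' *+ 2) + e / (c' *+ 2)) by field; lra.
by rewrite ltr_pM2l// ltrD.
Qed.

Lemma C0_fun_dominated (c : R) f g h : f \in C0_fun R X -> g \in C0_fun R X ->
  continuous h -> (forall x, `|h x| <= c * (`|f x| + `|g x|)) ->
  h \in C0_fun R X.
Proof.
move=> /C0_funP[_ vf] /C0_funP[_ vg] ch hfg; apply/C0_funP; split => //.
exact: vanishes_dominated hfg.
Qed.

Lemma C0_fun_bounded f : f \in C0_fun R X -> has_ubound (range (fun x => `|f x|)).
Proof.
move=> /C0_funP[cf vf].
have : compact (f @` [set x | 1 <= `|f x|]).
  apply: continuous_compact; last exact: vf.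
  exact: continuous_subspaceT.
move=> /(@compact_bounded R R^o)[B [_ /(_ (`|B| + 1))]].
have /[swap]/[apply] : B < `|B| + 1 by have := ler_norm B; lra.
move=> HB; exists (`|B| + 1) => _ [x _ <-].
have [fx|fx] := leP 1 `|f x|; first by apply: HB; exists x.
by have := normr_ge0 B; lra.
Qed.

Lemma C0_fun0 : 0 \in C0_fun R X.
Proof.
apply/C0_funP; split; first by move=> x; exact: cvg_cst.
move=> e e0; rewrite (_ : mkset _ = set0); first exact: compact0.
by apply/seteqP; split => x //=; rewrite normr0 leNgt e0.
Qed.

Lemma C0_fun_submod_closed : submod_closed (C0_fun R X).
Proof.
split; first exact: C0_fun0.
move=> a f g fC gC; apply: (@C0_fun_dominated (`|a| + 1) f g) => //.
  case/C0_funP: fC gC => cf _ /C0_funP[cg _] x.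
  by apply: cvgD; [apply: cvgM; [exact: cvg_cst|exact: cf]|exact: cg].
move=> x; apply: (le_trans (ler_normD _ _)); rewrite normrM.
have := mulr_ge0 (normr_ge0 a) (normr_ge0 (g x)).
by have := normr_ge0 (f x); nra.
Qed.

Lemma C0_fun_mul f g : f \in C0_fun R X -> g \in C0_fun R X ->
  (fun x => f x * g x) \in C0_fun R X.
Proof.
move=> fC gC; have [B HB] := C0_fun_bounded fC.
apply: (@C0_fun_dominated B g g) => //.
  case/C0_funP: fC gC => cf _ /C0_funP[cg _] x.
  by apply: cvgM; [exact: cf|exact: cg].
move=> x; rewrite normrM.
have fB : `|f x| <= B by apply: HB; exists x.
by have := normr_ge0 (f x); have := normr_ge0 (g x); nra.
Qed.

Lemma C0_fun_max f g : f \in C0_fun R X -> g \in C0_fun R X ->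
  (fun x => Num.max (f x) (g x)) \in C0_fun R X.
Proof.
move=> fC gC; apply: (@C0_fun_dominated 1 f g) => //.
  case/C0_funP: fC gC => cf _ /C0_funP[cg _] x.
  by apply: continuous_max; [exact: cf|exact: cg].
move=> x; rewrite mul1r.
by case: (leP (f x) (g x)) => _; rewrite ?lerDl ?lerDr normr_ge0.
Qed.

Lemma C0_fun_min f g : f \in C0_fun R X -> g \in C0_fun R X ->
  (fun x => Num.min (f x) (g x)) \in C0_fun R X.
Proof.
move=> fC gC; apply: (@C0_fun_dominated 1 f g) => //.
  case/C0_funP: fC gC => cf _ /C0_funP[cg _] x.
  by apply: continuous_min; [exact: cf|exact: cg].
move=> x; rewrite mul1r.
by case: (leP (f x) (g x)) => _; rewrite ?lerDl ?lerDr normr_ge0.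
Qed.

End C0_closure.

HB.instance Definition _ (R : realType) (X : topologicalType) :=
  GRing.isSubmodClosed.Build R (X -> R) (C0_fun R X) C0_fun_submod_closed.
HB.instance Definition _ (R : realType) (X : topologicalType) :=
  [SubChoice_isSubLmodule of C0 R X by <:].

Section C0_norm.
Context {R : realType} {X : topologicalType}.
Implicit Types f g : C0 R X.

Lemma C0_eqP f g : (forall x, f x = g x) -> f = g.
Proof. by move=> fg; apply: val_inj; apply/funext. Qed.

Definition C0_norm f : R := sup (range (fun x => `|f x|)).

Lemma C0_norm_ub f x : `|f x| <= C0_norm f.
Proof.
apply: ub_le_sup; last by exists x.
exact/C0_fun_bounded/valP.
Qed.

Lemma C0_norm_ge0 f : 0 <= C0_norm f.
Proof.
have [[_ [x _ _]]|/nonemptyPn e0] := pselect (range (fun x => `|f x|) !=set0).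
  exact: le_trans (normr_ge0 _) (C0_norm_ub f x).
by rewrite /C0_norm e0 sup0.
Qed.

Lemma C0_norm_le f (c : R) :
  0 <= c -> (forall x, `|f x| <= c) -> C0_norm f <= c.
Proof.
move=> c0 fc; have [ne|/nonemptyPn e0] :=
  pselect (range (fun x => `|f x|) !=set0).
  by apply: ge_sup => // _ [x _ <-].
by rewrite /C0_norm e0 sup0.
Qed.

Lemma C0_normD f g : C0_norm (f + g) <= C0_norm f + C0_norm g.
Proof.
apply: C0_norm_le => [|x]; first by rewrite addr_ge0// C0_norm_ge0.
by apply: le_trans (ler_normD _ _) _; rewrite lerD// C0_norm_ub.
Qed.

Lemma C0_normZ_le (a : R) f : C0_norm (a *: f) <= `|a| * C0_norm f.
Proof.
apply: C0_norm_le => [|x]; first by rewrite mulr_ge0// C0_norm_ge0.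
by rewrite normrM ler_wpM2l// C0_norm_ub.
Qed.

Lemma C0_normZ (a : R) f : C0_norm (a *: f) = `|a| * C0_norm f.
Proof.
apply/eqP; rewrite eq_le C0_normZ_le/=.
have [->|a0] := eqVneq a 0; first by rewrite normr0 mul0r C0_norm_ge0.
rewrite -ler_pdivlMl ?normr_gt0// -normfV.
by rewrite -{1}[f](scalerK a0) C0_normZ_le.
Qed.

Lemma C0_norm0_eq0 f : C0_norm f = 0 -> f = 0.
Proof.
move=> f0; apply: C0_eqP => x; apply/eqP; rewrite -normr_le0 -f0.
exact: C0_norm_ub.
Qed.

End C0_norm.

HB.instance Definition _ (R : realType) (X : topologicalType) :=
  Lmodule_isNormed.Build R (C0 R X) C0_normD C0_normZ C0_norm0_eq0.

Section C0_complete.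
Context {R : realType} {X : topologicalType}.

Lemma C0_norm_leP (f : C0 R X) (c : R) :
  0 <= c -> (forall x, `|f x| <= c) -> `|f| <= c.
Proof. exact: C0_norm_le. Qed.

Lemma C0_le_norm (f : C0 R X) x : `|f x| <= `|f|.
Proof. exact: C0_norm_ub. Qed.

Lemma C0_cauchy_cvg (F : set_system (C0 R X)) :
  ProperFilter F -> cauchy F -> cvg F.
Proof.
move=> FF Fc.
have Fc_ball (e : R) : 0 < e -> exists f : C0 R X, F [set h | `|f - h| < e].
  move=> e0; have /cauchyP/(_ e e0)[f Ff] := Fc.
  by exists f; move: Ff; rewrite -ball_normE.
pose G x : set_system R := (fun f : C0 R X => f x) @ F.
have GF x : ProperFilter (G x) by exact: fmap_proper_filter.
have Gcvg x : cvg (G x).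
  apply: R_complete; apply/cauchyP => e e0.
  have [f Ff] := Fc_ball e e0; exists (f x).
  change (F [set h : C0 R X | ball (f x) e (h x)]).
  apply: (filterS _ Ff) => h /= fh; rewrite -ball_normE /=.
  exact: le_lt_trans (C0_le_norm (f - h) x) fh.
pose g x : R := lim (G x).
have gP x : (fun f : C0 R X => f x) @ F --> g x by exact: Gcvg.
have close (e : R) f : 0 < e -> F [set h | `|f - h| < e] ->
    forall x, `|f x - g x| <= e.
  move=> e0 Ff x; apply/ler_addgt0Pr => r r0.
  have Fg : F [set h : C0 R X | `|g x - h x| < r].
    by have /cvgrPdist_lt/(_ r r0) := gP x.
  have [h [/= fh gh]] := filter_ex (filterI Ff Fg).
  rewrite (_ : f x - g x = (f x - h x) + (h x - g x)); last by ring.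
  apply: le_trans (ler_normD _ _) _; apply: lerD.
    exact: le_trans (C0_le_norm (f - h) x) (ltW fh).
  by rewrite distrC ltW.
have cg : continuous g.
  move=> x; apply/cvgrPdist_lt => e e0.
  have e4 : 0 < e / 4 by lra.
  have [f Ff] := Fc_ball _ e4.
  have fg := close _ _ e4 Ff.
  have cf : continuous f by case/C0_funP: (valP f).
  have /cvgrPdist_lt/(_ _ e4) := cf x.
  apply: filterS => y fxy /=.
  have fx := fg x; have fy := fg y.
  move: fx fy fxy; rewrite !(ler_norml, ltr_norml).
  by move=> /andP[? ?] /andP[? ?] /andP[? ?]; apply/andP; split; lra.
have vg : vanishes_at_infinity g.
  move=> e e0; have e2 : 0 < e / 2 by lra.
  have [f Ff] := Fc_ball _ e2; have fg := close _ _ e2 Ff.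
  have vf : vanishes_at_infinity f by case/C0_funP: (valP f).
  apply: (subclosed_compact _ (vf _ e2)); first exact: closed_level_set.
  move=> x /= egx; have := ler_normB (f x) (f x - g x).
  rewrite (_ : f x - (f x - g x) = g x); last by ring.
  by have := fg x; lra.
pose gC : C0 R X := MkC0 (introT (C0_funP g) (conj cg vg)).
apply/cvg_ex; exists gC; apply/cvgrPdist_le => e e0.
have e2 : 0 < e / 2 by lra.
have [f Ff] := Fc_ball _ e2; have fg := close _ _ e2 Ff.
apply: filterS Ff => h /= fh; apply: C0_norm_leP => [|x]; first exact: ltW.
change (`|g x - h x| <= e).
have fhx : `|f x - h x| < e / 2 by exact: le_lt_trans (C0_le_norm (f - h) x) fh.
move: (fg x) fhx; rewrite !(ler_norml, ltr_norml).
by move=> /andP[? ?] /andP[? ?]; apply/andP; split; lra.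
Qed.

End C0_complete.

HB.instance Definition _ (R : realType) (X : topologicalType) :=
  Uniform_isComplete.Build (C0 R X) C0_cauchy_cvg.

Section C0_lattice.
Context {R : realType} {X : topologicalType}.
Implicit Types f g h : C0 R X.

Definition C0_le f g : Prop := forall x, f x <= g x.

Definition C0_meet f g : C0 R X := MkC0 (C0_fun_min (valP f) (valP g)).
Definition C0_join f g : C0 R X := MkC0 (C0_fun_max (valP f) (valP g)).

Lemma C0_le_refl f : C0_le f f.
Proof. by move=> x. Qed.

Lemma C0_le_anti f g : C0_le f g -> C0_le g f -> f = g.
Proof.
by move=> fg gf; apply: C0_eqP => x; apply/eqP; rewrite eq_le fg gf.
Qed.

Lemma C0_le_trans g f h : C0_le f g -> C0_le g h -> C0_le f h.
Proof. by move=> fg gh x; exact: le_trans (fg x) (gh x). Qed.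

Lemma C0_le_meet h f g : C0_le h (C0_meet f g) <-> C0_le h f /\ C0_le h g.
Proof.
split=> [hfg|[hf hg] x]; last by rewrite /= le_min hf hg.
by split=> x; have := hfg x; rewrite /= le_min => /andP[].
Qed.

Lemma C0_join_le f g h : C0_le (C0_join f g) h <-> C0_le f h /\ C0_le g h.
Proof.
split=> [fgh|[fh gh] x]; last by rewrite /= ge_max fh gh.
by split=> x; have := fgh x; rewrite /= ge_max => /andP[].
Qed.

Lemma C0_leD2r h f g : C0_le f g -> C0_le (f + h) (g + h).
Proof. by move=> fg x; apply: lerD => //; exact: fg. Qed.

Lemma C0_scale_ge0 (a : R) f : 0 <= a -> C0_le 0 f -> C0_le 0 (a *: f).
Proof. by move=> a0 f0 x; apply: mulr_ge0 => //; exact: f0. Qed.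

Lemma C0_le_modulus_norm f g :
  C0_le (C0_join f (- f)) (C0_join g (- g)) -> `|f| <= `|g|.
Proof.
move=> fg; apply: C0_norm_leP => // x.
have : Num.max (f x) (- f x) <= Num.max (g x) (- g x) by exact: fg.
rewrite !maxrN => /le_trans; apply.
exact: C0_le_norm.
Qed.

End C0_lattice.

HB.instance Definition _ (R : realType) (X : topologicalType) :=
  isBanachLattice.Build R (C0 R X) C0_le_refl C0_le_anti C0_le_trans
    C0_le_meet C0_join_le C0_leD2r C0_scale_ge0 C0_le_modulus_norm.

Section C0_mul.
Context {R : realType} {X : topologicalType}.

(* C0 R X has no unit unless X is compact, hence is not a ringType. *)
Definition C0_mul (f g : C0 R X) : C0 R X :=
  MkC0 (C0_fun_mul (valP f) (valP g)).

Definition separates_points (M : set (C0 R X)) :=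
  forall x y : X, x <> y -> exists2 f, M f & f x <> f y.

End C0_mul.

Notation "f ** g" := (C0_mul f g) (at level 40, left associativity) : ring_scope.

(* Main.v *)
(** Let [h = f / f0], where [|f| <= c f0]; such [f] are dense, by truncation.
    Fix [d > 0]. Where [f0 x < d], positivity gives [|L_n f| <= c L_n f0], so
    both [f] and [L_n f] are small there. On the compact set
    [{d <= f0} * {d <= f0}] the separating functions give, for every [e > 0],
    [|h(x) f0(y) - f(y)| <= e f0(y) + Q x y], where [Q x y] is a nonnegative
    combination of terms [f0(y) (g(x) - g(y))^2]. If [f0 y < d] the left-hand
    side is at most [2 c min(f0(y), d)], and [L_n (min f0 d)] has norm
    [O(d)]. Now apply [L_n] in the variable [y] and evaluate at [x]: expanding
    the squares, [L_n (Q x) x] tends to [Q x x = 0] uniformly in [x]. *)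

Require Import Defs.
From HB Require Import structures.
From mathcomp Require Import all_boot all_order all_algebra.
From mathcomp Require Import all_classical all_reals all_analysis.
From mathcomp Require Import ring lra.

Set Implicit Arguments.
Unset Strict Implicit.
Unset Printing Implicit Defensive.

Import Order.TTheory GRing.Theory Num.Theory.
Import numFieldNormedType.Exports.

Local Open Scope classical_set_scope.
Local Open Scope ring_scope.

(** * Uniform operator bounds and choice of constants *)

Lemma uniformly_bounded_operators {R : realType} {E : banachLatticeType R}
    (L : nat -> {linear E -> E}) :
  (ereal_sup (range (fun n => operator_norm (L n))) < +oo)%E ->
  exists2 B : R, 0 <= B & forall n u, `|L n u| <= B * `|u|.
Proof.
set s := ereal_sup _ => s_fin.
have Ls n u : `|u| <= 1 -> (`|L n u|%:E <= s)%E.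
  move=> u1; apply: (@le_trans _ _ (operator_norm (L n))).
    by apply: ereal_sup_ubound; exists u.
  by apply: ereal_sup_ubound; exists n.
(* The test vector [0] bounds [s] below, so [s < +oo] makes it a real number. Homogeneity then
   extends the bound from the unit ball to all [u]. *)
have s0 : (0%:E <= s)%E.
  by have := Ls 0%N 0; rewrite linear0 !normr0; apply.
have sE : s = (fine s)%:E by rewrite fineK// ge0_fin_numE.
exists (fine s) => [|n u]; first by rewrite -lee_fin -sE.
have [->|u0] := eqVneq u 0; first by rewrite linear0 !normr0 mulr0.
have nu : 0 < `|u| by rewrite normr_gt0.
have := Ls n (`|u|^-1 *: u).
rewrite linearZ/= !normrZ normfV normr_id mulVf ?gt_eqF// => /(_ (lexx _)).
by rewrite sE lee_fin mulrC ler_pdivrMr.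
Qed.

Lemma exists_small_factor (R : realType) (a r : R) : 0 <= a -> 0 < r ->
  exists2 e, 0 < e & a * e <= r.
Proof.
(* The shift by 1 covers [a = 0]. *)
move=> a0 r0; have a1 : 0 < a + 1 by lra.
exists (r / (a + 1)); first by rewrite divr_gt0.
by rewrite mulrA ler_pdivrMr//; lra.
Qed.

(** * Continuity, truncation and density in [C0 R X] *)

Section korovkin_C0.
Context {R : realType} {X : topologicalType}.
Implicit Types (f g u v : C0 R X) (Q : X -> C0 R X).

Lemma C0_continuous f : continuous f.
Proof. by case/C0_funP: (valP f). Qed.

Lemma C0_fun_truncation f (d : R) : 0 <= d ->
  (fun x => Num.min `|f x| d) \in C0_fun R X.
Proof.
move=> d0; apply: (@C0_fun_dominated _ _ 1 f f); try exact: valP.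
  move=> x; apply: (@continuous_min _ _ (fun x => `|f x|) (fun=> d)).
    by apply: cvg_norm; exact: C0_continuous.
  exact: cvg_cst.
move=> x; rewrite mul1r ger0_norm ?le_min ?normr_ge0//.
by apply: (@le_trans _ _ `|f x|); rewrite ?ge_min ?lexx// lerDl.
Qed.

Lemma C0_continuous_fst f : continuous (fun z : X * X => f z.1).
Proof.
move=> z; apply: (@cvg_comp _ _ _ fst f); first exact: cvg_fst.
exact: C0_continuous.
Qed.

Lemma C0_continuous_snd f : continuous (fun z : X * X => f z.2).
Proof.
move=> z; apply: (@cvg_comp _ _ _ snd f); first exact: cvg_snd.
exact: C0_continuous.
Qed.

Definition C0_truncation f (d : R) (d0 : 0 <= d) : C0 R X :=
  MkC0 (C0_fun_truncation f d0).

(** Clamp [f] between [- c f0] and [c f0]. On the compact set where [e <= |f|], [f0] has a positive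
    minimum, so a large [c] leaves [f] unchanged there; elsewhere clamping only moves values towards
    0, by less than [e]. *)
Lemma approx_dominated f0 f (e : R) : (forall x, 0 < f0 x) -> 0 < e ->
  exists g, (exists2 c : R, 0 <= c & forall x, `|g x| <= c * f0 x)
            /\ `|f - g| <= e.
Proof.
move=> f00 e0.
have [m m0 mP] : exists2 m : R, 0 < m & forall x, e <= `|f x| -> m <= f0 x.
  have vf : vanishes_at_infinity f by case/C0_funP: (valP f).
  have [[x0 fx0]|ne] := pselect ([set x | e <= `|f x|] !=set0).
    have [|||z _ zm] := @compact_EVT_min _ R f0 [set x | e <= `|f x|].
    - by exists x0.
    - exact: vf.
    - exact/continuous_subspaceT/C0_continuous.
    by exists (f0 z) => // x fx; apply: zm; rewrite inE.
  (* The level set is empty here, so any positive [m] would do. *)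
  by exists 1 => // x fx; exfalso; apply: ne; exists x.
pose c := `|f| / m.
have c0 : 0 <= c by rewrite divr_ge0// ltW.
pose g := C0_join (- (c *: f0)) (C0_meet (c *: f0) f).
have gE x : g x = Num.max (- (c * f0 x)) (Num.min (c * f0 x) (f x)) by [].
exists g; split.
  exists c => // x; rewrite gE.
  have p : 0 <= c * f0 x by rewrite mulr_ge0// ltW.
  by rewrite ler_norml le_max lexx/= ge_max ge_min lexx/=; lra.
apply: C0_norm_leP => [|x]; first exact: ltW.
rewrite [X in `|X|](_ : _ = f x - g x)// gE.
have p : 0 <= c * f0 x by rewrite mulr_ge0// ltW.
have [fe|fe] := leP e `|f x|.
  have : `|f x| <= c * f0 x.
    apply: (le_trans (C0_le_norm f x)).
    by rewrite /c -mulrA ler_peMr// mulrC ler_pdivlMr// mul1r mP.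
  rewrite ler_norml => /andP[h1 h2].
  by rewrite (min_idPr h2) (max_idPr h1) subrr normr0 ltW.
move: fe; rewrite ltr_norml => /andP[h1 h2].
rewrite ler_norml.
by case: (leP (c * f0 x) (f x)) => ?;
  by case: (leP (- (c * f0 x)) _) => ?; apply/andP; split; lra.
Qed.

(** * Convergence along the diagonal, and penalties *)

Section diagonal.
Variables (L : nat -> {linear C0 R X -> C0 R X}).

(** The function fed to [L n] varies with the point [x] at which the result is evaluated, so this is
    not norm convergence of a single sequence. *)
Definition diagonal_cvg Q := forall e : R, 0 < e ->
  \forall n \near \oo, forall x, `|L n (Q x) x - Q x x| <= e.

Lemma diagonal_cvg_cst u : L n u @[n --> \oo] --> u ->
  diagonal_cvg (fun=> u).
Proof.
move=> Lu e e0; have /cvgrPdist_le/(_ e e0) := Lu.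
apply: filterS => n Ln x; apply: le_trans Ln; rewrite distrC.
exact: (C0_le_norm (u - L n u) x).
Qed.

Lemma diagonal_cvgD Q1 Q2 : diagonal_cvg Q1 -> diagonal_cvg Q2 ->
  diagonal_cvg (fun x => Q1 x + Q2 x).
Proof.
move=> h1 h2 e e0; have e2 : 0 < e / 2 by lra.
apply: filterS2 (h1 _ e2) (h2 _ e2) => n H1 H2 x; rewrite linearD/=.
rewrite [X in `|X|](_ : _ = (L n (Q1 x) x - Q1 x x) + (L n (Q2 x) x - Q2 x x)).
  by apply: (le_trans (ler_normD _ _)); have := H1 x; have := H2 x; lra.
rewrite -[X in X - _]/(L n (Q1 x) x + L n (Q2 x) x).
by rewrite -[X in _ - X]/(Q1 x x + Q2 x x); ring.
Qed.

(** For the operator, [a x] is a scalar and passes through by linearity; boundedness of [a] keeps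
    the estimate uniform in [x]. *)
Lemma diagonal_cvgZ (a : X -> R) (b : R) Q : (forall x, `|a x| <= b) ->
  diagonal_cvg Q -> diagonal_cvg (fun x => a x *: Q x).
Proof.
move=> ab h e e0.
have b1 : 0 < `|b| + 1 by have := normr_ge0 b; lra.
have eb : 0 < e / (`|b| + 1) by rewrite divr_gt0.
apply: filterS (h _ eb) => n H x; rewrite linearZ/=.
rewrite -[X in X - _]/(a x * L n (Q x) x) -[X in _ - X]/(a x * Q x x).
rewrite -mulrBr normrM.
apply: (@le_trans _ _ ((`|b| + 1) * (e / (`|b| + 1)))).
  apply: ler_pM => //; have := ab x; have := ler_norm b; lra.
by rewrite mulrC divfK// gt_eqF.
Qed.

Lemma diagonal_cvg_sum (I : Type) (r : seq I) (Q : I -> X -> C0 R X) :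
  (forall i, diagonal_cvg (Q i)) ->
  diagonal_cvg (fun x => \sum_(i <- r) Q i x).
Proof.
move=> h; elim: r => [|i r IH].
  move=> e e0; apply: nearW => n x.
  by rewrite big_nil linear0 subrr normr0 ltW.
rewrite (_ : (fun x => _) = (fun x => Q i x + \sum_(i <- r) Q i x)).
  exact: diagonal_cvgD.
by apply/funext => x; rewrite big_cons.
Qed.

(** Joint continuity serves the compactness argument on [X * X]; vanishing on the diagonal makes
    [L n (Q x) x] tend to 0 uniformly. *)
Record diagonal_penalty Q : Prop := {
  penalty_ge0 : forall x y, 0 <= Q x y ;
  penalty_diag : forall x, Q x x = 0 ;
  penalty_cont : continuous (fun z : X * X => Q z.1 z.2) ;
  penalty_cvg : diagonal_cvg Q }.

Lemma diagonal_penalty0 : diagonal_penalty (fun=> 0).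
Proof.
split=> //; first by move=> z; exact: cvg_cst.
by apply: diagonal_cvg_cst; under eq_fun do rewrite linear0; exact: cvg_cst.
Qed.

Lemma diagonal_penaltyD Q1 Q2 : diagonal_penalty Q1 -> diagonal_penalty Q2 ->
  diagonal_penalty (fun x => Q1 x + Q2 x).
Proof.
move=> [p1 d1 c1 v1] [p2 d2 c2 v2]; split.
- by move=> x y; apply: addr_ge0; [exact: p1|exact: p2].
- by move=> x; rewrite -[LHS]/(Q1 x x + Q2 x x) d1 d2 addr0.
- by move=> z; apply: cvgD; [exact: c1|exact: c2].
- exact: diagonal_cvgD.
Qed.

Lemma diagonal_penaltyZ (a : R) Q : 0 <= a -> diagonal_penalty Q ->
  diagonal_penalty (fun x => a *: Q x).
Proof.
move=> a0 [p d c v]; split.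
- by move=> x y; apply: mulr_ge0 => //; exact: p.
- by move=> x; rewrite -[LHS]/(a * Q x x) d mulr0.
- by move=> z; apply: cvgM; [exact: cvg_cst|exact: c].
- by apply: (@diagonal_cvgZ (fun=> a) `|a|).
Qed.

(** Expanding the squares gives coefficients depending only on [x] and bounded by norms of the
    [f i]. The quadratic terms all have coefficient 1, so convergence on their sum suffices. *)
Lemma diagonal_penalty_squares f0 (n : nat) (f : 'I_n -> C0 R X) :
  (forall x, 0 < f0 x) -> L n f0 @[n --> \oo] --> f0 ->
  (forall i, L n (f0 ** f i) @[n --> \oo] --> f0 ** f i) ->
  L k (f0 ** (\sum_(i < n) f i ** f i)) @[k --> \oo]
    --> f0 ** (\sum_(i < n) f i ** f i) ->
  exists2 Q, diagonal_penalty Q &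
    forall x y, Q x y = f0 y * \sum_(i < n) (f i x - f i y) ^+ 2.
Proof.
move=> f00 L0 L1 L2.
pose Q x := f0 ** (\sum_(i < n) f i ** f i) +
  \sum_(i < n) ((f i x ^+ 2) *: f0 + (- 2 * f i x) *: (f0 ** f i)).
have C0_sum (I : Type) (r : seq I) (u : I -> C0 R X) x :
    (\sum_(i <- r) u i) x = \sum_(i <- r) u i x.
  elim: r => [|i r IH]; first by rewrite !big_nil.
  by rewrite !big_cons -IH.
have QE x y : Q x y = f0 y * \sum_(i < n) (f i x - f i y) ^+ 2.
  rewrite -[LHS]/(f0 y * (\sum_(i < n) f i ** f i) y + (\sum_(i < n) _ : C0 R X) y).
  rewrite !C0_sum !mulr_sumr -big_split/=; apply: eq_bigr => i _.
  rewrite -[X in _ * X + _]/(f i y * f i y).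
  rewrite -[X in _ + X]/(f i x ^+ 2 * f0 y + - 2 * f i x * (f0 y * f i y)).
  by ring.
exists Q => //; split.
- move=> x y; rewrite QE; apply: mulr_ge0; first exact: ltW.
  by apply: sumr_ge0 => i _; exact: sqr_ge0.
- by move=> x; rewrite QE big1 ?mulr0// => i _; rewrite subrr expr0n.
- rewrite (_ : (fun z => _) =
    (fun z : X * X => f0 z.2 * \sum_(i < n) (f i z.1 - f i z.2) ^+ 2)); last first.
    by apply/funext => z; rewrite QE.
  move=> z; apply: cvgM; first exact: C0_continuous_snd.
  apply: cvg_big => [|i _]; first exact: add_continuous.
  apply: (@cvg_comp _ _ _ _ (fun t : R => t ^+ 2)); last exact: exprn_continuous.
  by apply: cvgB; [exact: C0_continuous_fst|exact: C0_continuous_snd].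
- apply: diagonal_cvgD; first exact: diagonal_cvg_cst.
  apply: diagonal_cvg_sum => i; apply: diagonal_cvgD.
    apply: (@diagonal_cvgZ _ (`|f i| ^+ 2)); last exact: diagonal_cvg_cst.
    move=> x; rewrite normrX; apply: lerXn2r; rewrite ?nnegrE//.
    exact: C0_le_norm.
  apply: (@diagonal_cvgZ _ (2 * `|f i|)); last exact: diagonal_cvg_cst.
  by move=> x; rewrite normrM normrN normr_nat ler_pM2l ?C0_le_norm.
Qed.

(** On the diagonal the left-hand side vanishes and [e * f0 y] is positive; off it, a multiple of a
    separating penalty is large enough. Compactness of the square of [d <= f0] makes one penalty
    work throughout. *)
Lemma diagonal_penalty_dominates f0 f (e d : R) :
  (forall x, 0 < f0 x) ->
  (forall x y, x <> y -> exists2 Q, diagonal_penalty Q & 0 < Q x y) ->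
  0 < e -> 0 < d ->
  exists2 Q, diagonal_penalty Q & forall x y, d <= f0 x -> d <= f0 y ->
    `|f x / f0 x * f0 y - f y| <= e * f0 y + Q x y.
Proof.
move=> f00 sepQ e0 d0.
pose G (z : X * X) := f z.1 / f0 z.1 * f0 z.2 - f z.2.
(* Indexing a near-covering by penalties ordered pointwise replaces the
   extraction of a finite subcover: sums of penalties are upper bounds. *)
pose F : set_system (X -> C0 R X) := [set S | exists2 Q0, diagonal_penalty Q0 &
  forall Q, diagonal_penalty Q -> (forall x y, Q0 x y <= Q x y) -> S Q].
have FF : Filter F.
  split; first by exists (fun=> 0) => //; exact: diagonal_penalty0.
    move=> S T [Q1 p1 S1] [Q2 p2 T2].
    exists (fun x => Q1 x + Q2 x); first exact: diagonal_penaltyD.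
    move=> Q pQ Q12; split; [apply: S1|apply: T2] => // x y.
      by apply: le_trans (Q12 x y); rewrite lerDl; exact: penalty_ge0.
    by apply: le_trans (Q12 x y); rewrite lerDr; exact: penalty_ge0.
  by move=> S T ST [Q0 p0 S0]; exists Q0 => // Q pQ /(S0 Q pQ)/ST.
have K2 : compact ([set x | d <= `|f0 x|] `*` [set x | d <= `|f0 x|]).
  have vf0 : vanishes_at_infinity f0 by case/C0_funP: (valP f0).
  by apply: compact_setX; exact: vf0.
have cG : continuous G.
  move=> z; apply: cvgB; last exact: C0_continuous_snd.
  apply: cvgM; last exact: C0_continuous_snd.
  apply: cvgM; first exact: C0_continuous_fst.
  by apply: cvgV; [rewrite gt_eqF|exact: C0_continuous_fst].
have /compact_near_coveringP/(_ _ F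
  (fun Q z => `|G z| <= e * f0 z.2 + Q z.1 z.2) FF)[] := K2.
  move=> z _.
  have [Q0 p0 zQ0] : exists2 Q0, diagonal_penalty Q0 &
      0 < e * f0 z.2 + Q0 z.1 z.2 - `|G z|.
    have ef0 : 0 < e * f0 z.2 by rewrite mulr_gt0.
    have [z12|/sepQ[Q1 p1 z1]] := pselect (z.1 = z.2).
      exists (fun=> 0); first exact: diagonal_penalty0.
      rewrite -[X in _ + X - _]/(0 : R) /G z12 divfK ?gt_eqF//.
      by rewrite subrr normr0 addr0 subr0.
    (* Scaled to take exactly the value [|G z|] at [z]; the term [e * f0] makes the inequality
       strict. *)
    exists (fun x => (`|G z| / Q1 z.1 z.2) *: Q1 x).
      by apply: diagonal_penaltyZ => //; rewrite divr_ge0// ltW.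
    rewrite -[X in _ + X - _]/(`|G z| / Q1 z.1 z.2 * Q1 z.1 z.2).
    by rewrite divfK ?gt_eqF// addrK.
  have cW : continuous (fun z => e * f0 z.2 + Q0 z.1 z.2 - `|G z|).
    move=> t; apply: cvgB; last by apply: cvg_norm; exact: cG.
    apply: cvgD; last exact: (penalty_cont p0).
    by apply: cvgM; [exact: cvg_cst|exact: C0_continuous_snd].
  (* The strict inequality persists near [z], and every penalty above [Q0] preserves it. *)
  have /cvgr_gt/(_ _ zQ0) := cW z.
  exists ([set t | 0 < e * f0 t.2 + Q0 t.1 t.2 - `|G t|],
          [set Q : X -> C0 R X | forall x y, Q0 x y <= Q x y]).
    by split => //; exists Q0.
  move=> [t Q] [/= tQ0 Q0Q]; have := Q0Q t.1 t.2; lra.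
move=> Q0 p0 Q0P; exists Q0 => // x y dx dy.
by apply: (Q0P Q0 p0 _ (x, y)) => //; split => /=; rewrite ger0_norm// ltW.
Qed.

(** * Convergence for positive, uniformly bounded operators *)

Lemma positive_operator_abs (T : {linear C0 R X -> C0 R X}) u v :
  positive_operator T -> (forall y, `|u y| <= v y) ->
  forall x, `|T u x| <= T v x.
Proof.
move=> Tpos uv x; rewrite ler_norml; apply/andP; split.
  have : 0 <= T (v + u) x.
    apply: Tpos => y; change (0 <= v y + u y); have := uv y.
    by rewrite ler_norml => /andP[? ?]; lra.
  by rewrite linearD -[X in _ <= X -> _]/(T v x + T u x); lra.
have : 0 <= T (v - u) x.
  apply: Tpos => y; change (0 <= v y - u y); have := uv y.
  by rewrite ler_norml => /andP[? ?]; lra.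
by rewrite linearB -[X in _ <= X -> _]/(T v x - T u x); lra.
Qed.

Hypothesis L_pos : forall n, positive_operator (L n).
Variable B : R.
Hypotheses (B0 : 0 <= B) (LB : forall n u, `|L n u| <= B * `|u|).

Lemma cvg_dominated f0 f (c : R) :
  (forall x, 0 < f0 x) -> L n f0 @[n --> \oo] --> f0 ->
  (forall x y, x <> y -> exists2 Q, diagonal_penalty Q & 0 < Q x y) ->
  0 <= c -> (forall x, `|f x| <= c * f0 x) ->
  L n f @[n --> \oo] --> f.
Proof.
move=> f00 Lf0 sepQ c0 fc; apply/cvgrPdist_le => /= r r0.
have r4 : 0 < r / 4 by lra.
(* The error [r] is split into four quarters, for [e * f0], the truncation, the convergence on [f0]
   and the penalty. In [B + 1], [B] pays for [L n t] and 1 for the region [f0 x < d]. *)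
have [e e0 eP] := exists_small_factor (mulr_ge0 B0 (normr_ge0 f0)) r4.
have p : 0 <= 2 * c * (B + 1) by have := mulr_ge0 c0 B0; lra.
have [d d0 dP] := exists_small_factor p r4.
have [q q0 qP] := exists_small_factor c0 r4.
have [Q pQ QP] := diagonal_penalty_dominates f f00 sepQ e0 d0.
pose t := C0_truncation f0 (ltW d0).
have tE y : t y = Num.min (f0 y) d by rewrite /t/= gtr0_norm.
have normt : `|t| <= d.
  apply: C0_norm_leP => [|y]; first exact: ltW.
  by rewrite tE ger0_norm ?ge_min ?lexx ?orbT// le_min !ltW.
apply: filterS2 (diagonal_cvg_cst Lf0 q0) (penalty_cvg pQ r4) => n Hf0 HQ.
apply: C0_norm_leP => [|x]; first exact: ltW.
rewrite distrC -[X in `|X|]/(L n f x - f x).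
have H0 := Hf0 x.
have cH0 : c * `|L n f0 x - f0 x| <= c * q by rewrite ler_wpM2l.
have [xd|dx] := ltP (f0 x) d.
  have h1 : `|L n f x| <= c * L n f0 x.
    have := @positive_operator_abs _ f (c *: f0) (L_pos n) fc x.
    by rewrite linearZ.
  have h2 : c * f0 x <= c * d by rewrite ler_wpM2l// ltW.
  have h3 := fc x.
  have h4 : c * (L n f0 x - f0 x) <= c * `|L n f0 x - f0 x|.
    by rewrite ler_wpM2l// ler_norm.
  have h5 : 0 <= c * B * d by rewrite !mulr_ge0// ltW.
  by apply: (le_trans (ler_normB _ _)); lra.
pose h := f x / f0 x.
have hc : `|h| <= c by rewrite normrM normfV (gtr0_norm (f00 x)) ler_pdivrMr.
(* Where [f0 y < d], the truncation [t] equals [f0] and the bound [2 c f0 y] suffices; elsewhere the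
   penalty takes over. *)
have Hdiff y : `|(h *: f0 - f) y| <= (e *: f0 + (2 * c) *: t + Q x) y.
  rewrite -[X in `|X|]/(h * f0 y - f y).
  rewrite -[leRHS]/(e * f0 y + 2 * c * t y + Q x y) tE.
  have ef0 : 0 <= e * f0 y by rewrite mulr_ge0// ltW.
  have Q0 := penalty_ge0 pQ x y.
  have [yd|dy] := ltP (f0 y) d.
    have h1 : `|h * f0 y| <= c * f0 y.
      by rewrite normrM (gtr0_norm (f00 y)) ler_wpM2r// ltW.
    by have := fc y; have := ler_normB (h * f0 y) (f y); lra.
  have := QP _ _ dx dy.
  by have := mulr_ge0 c0 (ltW d0); rewrite -/h; lra.
have := positive_operator_abs (L_pos n) Hdiff x.
rewrite linearB !linearD !linearZ/=.
rewrite -[X in `|X|]/(h * L n f0 x - L n f x).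
rewrite -[leRHS]/(e * L n f0 x + 2 * c * L n t x + L n (Q x) x) => main.
have h1 : e * L n f0 x <= r / 4.
  apply: le_trans eP; rewrite mulrC ler_pM2r//; apply: le_trans (LB n f0).
  exact: le_trans (ler_norm _) (C0_le_norm _ x).
have h2 : 2 * c * L n t x <= 2 * c * (B * d).
  rewrite ler_wpM2l ?mulr_ge0//; apply: (le_trans (ler_norm _)).
  apply: (le_trans (C0_le_norm _ x)); apply: (le_trans (LB n t)).
  by rewrite ler_wpM2l.
have h3 : L n (Q x) x <= r / 4.
  by have := HQ x; rewrite penalty_diag// subr0; exact/le_trans/ler_norm.
have h4 : `|h * (L n f0 x - f0 x)| <= c * q.
  by rewrite normrM; apply: ler_pM.
have h5 : 0 <= c * d by rewrite mulr_ge0// ltW.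
(* Uses [h * f0 x = f x]; the second term was bounded by [main]. *)
have -> : L n f x - f x =
    h * (L n f0 x - f0 x) - (h * L n f0 x - L n f x).
  by rewrite /h; field; rewrite gt_eqF.
by apply: (le_trans (ler_normB _ _)); lra.
Qed.

Lemma korovkin_diagonal_penalty f0 :
  (forall x, 0 < f0 x) -> L n f0 @[n --> \oo] --> f0 ->
  (forall x y, x <> y -> exists2 Q, diagonal_penalty Q & 0 < Q x y) ->
  forall f, L n f @[n --> \oo] --> f.
Proof.
move=> f00 Lf0 sepQ f; apply/cvgrPdist_le => /= r r0.
(* Three errors: [f - g] and [g - L n g] cost one unit each, [L n (f - g)] costs [B] units. *)
have B2 : 0 < B + 2 by rewrite ltr_wpDl.
have d0 : 0 < r / (B + 2) by rewrite divr_gt0.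
have [g [[c c0 gc] fg]] := approx_dominated f f00 d0.
have /cvgrPdist_le/(_ _ d0) := cvg_dominated f00 Lf0 sepQ c0 gc.
apply: filterS => n gLg.
have -> : f - L n f = (f - g) + (g - L n g) - L n (f - g).
  by rewrite linearB/= opprB !addrA !subrK.
apply: (le_trans (ler_normB _ _)).
have := ler_normD (f - g) (g - L n g).
have := LB n (f - g).
have : B * `|f - g| <= B * (r / (B + 2)) by rewrite ler_wpM2l.
have : r / (B + 2) + r / (B + 2) + B * (r / (B + 2)) = r.
  by field; rewrite gt_eqF.
lra.
Qed.

End diagonal.
End korovkin_C0.

(** * The Korovkin subsets of the statement *)

Lemma korovkin_separating (R : realType) (X : topologicalType)
    (f0 : C0 R X) (M : set (C0 R X)) :
  (forall x, 0 < f0 x) -> separates_points M ->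
  korovkin_subset
    ([set f0] `|` [set f0 ** f | f in M] `|` [set f0 ** (f ** f) | f in M]).
Proof.
move=> f00 sepM L L_pos /uniformly_bounded_operators[B B0 LB] LS.
have Lf0 : L n f0 @[n --> \oo] --> f0 by apply: LS; left; left.
apply: (korovkin_diagonal_penalty L_pos B0 LB f00 Lf0) => x y /sepM[g Mg gxy].
(* For each pair of points, a family of one function gives the penalty, so [M] may be infinite. *)
have [||Q pQ QE] := @diagonal_penalty_squares _ _ L f0 1 (fun=> g) f00 Lf0.
- by move=> _; apply: LS; left; right; exists g.
- by rewrite big_ord1; apply: LS; right; exists g.
exists Q => //; rewrite QE big_ord1 mulr_gt0// exprn_even_gt0//= subr_eq0.
exact/eqP.
Qed.

(** The penalty built from the whole family separates all pairs at once, which is why only the sum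
    of the squares is tested. *)
Lemma korovkin_separating_finite (R : realType) (X : topologicalType)
    (f0 : C0 R X) (n : nat) (f : 'I_n -> C0 R X) :
  (forall x, 0 < f0 x) -> separates_points (range f) ->
  korovkin_subset
    ([set f0] `|` range (fun i => f0 ** f i)
       `|` [set f0 ** (\sum_(i < n) f i ** f i)]).
Proof.
move=> f00 sepf L L_pos /uniformly_bounded_operators[B B0 LB] LS.
have Lf0 : L n f0 @[n --> \oo] --> f0 by apply: LS; left; left.
apply: (korovkin_diagonal_penalty L_pos B0 LB f00 Lf0).
move=> x y /sepf[_ [i _ <-] fxy].
have [||Q pQ QE] := @diagonal_penalty_squares _ _ L f0 n f f00 Lf0.
- by move=> j; apply: LS; left; right; exists j.
- by apply: LS; right.
(* The separating index contributes a positive square, the others nonnegative ones. *)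
exists Q => //; rewrite QE mulr_gt0// (bigD1 i)//= ltr_pwDl//.
  by rewrite exprn_even_gt0//= subr_eq0; exact/eqP.
by apply: sumr_ge0 => j _; exact: sqr_ge0.
Qed.

Theorem theorem6p6 (R : realType) (X : topologicalType)
    (f0 : C0 R X) (M : set (C0 R X)) :
  locally_compact [set: X] -> hausdorff_space X -> @second_countable X ->
  (forall x, 0 < f0 x) -> separates_points M ->
  [/\ korovkin_subset
        ([set f0] `|` [set f0 ** f | f in M] `|` [set f0 ** (f ** f) | f in M]),
      (forall (n : nat) (f : 'I_n -> C0 R X), (1 <= n)%N -> M = range f ->
        korovkin_subset
          ([set f0] `|` range (fun i => f0 ** f i)
             `|` [set f0 ** (\sum_(i < n) f i ** f i)]))
    & (injective f0 -> korovkin_subset [set f0; f0 ** f0; f0 ** (f0 ** f0)])].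
Proof.
move=> _ _ _ f00 sepM; split.
- exact: korovkin_separating.
- move=> n f _ Mf; apply: korovkin_separating_finite => //.
  by rewrite -Mf.
- move=> f0_inj.
  (* Injectivity lets [f0] itself play the role of [M], whose images are then the square and cube of
     [f0]. *)
  have /(korovkin_separating f00) : separates_points [set f0].
    by move=> x y xy; exists f0 => // /f0_inj.
  by rewrite !image_set1.
Qed.
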